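(* Let $f\in\mathbb{R}^{d_1\times\cdots\times d_m}$ be a nonnegative weakly irreducible tensor and $1<p_1,\ldots,p_m<\infty$ such that there exists $i\in[m]$ with $(m-1)p_i'\le p_k$ for every $k\in[m]\setminus\{i\}$. Then there exists $\mathbf x^*\in\mathcal S^{d-d_i}_{++}$ with $Q_i(\mathbf x^* )=\|f\|_{p_1,\ldots,p_m}$, and for every $\mathbf z\in\mathcal S^{d-d_i}_{++}$, $$\gamma_i^-(\mathbf z)\le\|f\|_{p_1,\ldots,p_m}^{p_i'(m-1)}\le\gamma_i^+(\mathbf z),$$ with equality if and only if $\mathbf z=\mathbf x^*$.
   Context: $f$ is identified with the multilinear form $f(\mathbf x)=\sum f_{j_1,\ldots,j_m}x_{1,j_1}\cdots x_{m,j_m}$ on $\prod_k\mathbb{R}^{d_k}$; $\nabla_kf(\mathbf x)$ is the vector of partials $\partial f/\partial x_{k,j_k}$ (independent of $\mathbf x_k$, so $\nabla_if$ is defined on $\mathcal R^{d-d_i}=\prod_{k\ne i}\mathbb{R}^{d_k}$). $p'=p/(p-1)$; $\psi_q(\mathbf y)_j=|y_j|^{q-1}\mathrm{sign}(y_j)$. $\mathcal S^{d-d_i}_{++}=\{\mathbf x\in\mathcal R^{d-d_i}:\mathbf x>0,\|\mathbf x_k\|_{p_k}=1\ \forall k\ne i\}$. $Q(\mathbf x)=|f(\mathbf x)|/\prod_k\|\mathbf x_k\|_{p_k}$, $\|f\|_{p_1,\ldots,p_m}=\max Q$; $Q_i(\mathbf x)=\|\nabla_if(\mathbf x)\|_{p_i'}/\prod_{k\ne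 i}\|\mathbf x_k\|_{p_k}$. For $k\ne i$, $s_{i,k}(\mathbf x)=\psi_{p_k'}\big(\nabla_kf(\mathbf x_1,\ldots,\mathbf x_{i-1},\psi_{p_i'}(\nabla_if(\mathbf x)),\mathbf x_{i+1},\ldots,\mathbf x_m)\big)$ with entries $s_{i,k,j_k}$. $\gamma_i^-(\mathbf x)=\prod_{k\ne i}\min_{j_k\in[d_k]}(s_{i,k,j_k}(\mathbf x)/x_{k,j_k})^{p_k-1}$ and $\gamma_i^+(\mathbf x)=\prod_{k\ne i}\max_{j_k\in[d_k]}(s_{i,k,j_k}(\mathbf x)/x_{k,j_k})^{p_k-1}$. Weak irreducibility: the undirected graph on $\bigcup_k\{k\}\times[d_k]$ with $(k,j_k)\sim(l,j_l)$ ($k\ne l$) iff $f_{j_1,\ldots,j_m}>0$ for some choice of the remaining indices, is connected. *)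

(* Defs.v *)
From HB Require Import structures.
From mathcomp Require Import all_boot all_order all_algebra.
From mathcomp Require Import all_classical all_reals all_analysis.
Unset Printing Implicit Defensive.
Import Order.TTheory GRing.Theory Num.Theory.
Local Open Scope ring_scope.
Local Open Scope classical_set_scope.

Section Tensor.
Context {R : realType} {m : nat} (d : 'I_m -> nat).

Definition midx := {dffun forall k : 'I_m, 'I_(d k)}.

Definition vecs := forall k : 'I_m, 'I_(d k) -> R.

Definition hconj (p : R) : R := p / (p - 1).

Definition psi (q : R) {n : nat} (y : 'I_n -> R) : 'I_n -> R :=
  fun j => Num.sg (y j) * (`|y j| `^ (q - 1)).

Definition lpnorm (p : R) {n : nat} (y : 'I_n -> R) : R :=
  (\sum_j `|y j| `^ p) `^ (p^-1).

Definition tform (f : midx -> R) (x : vecs) : R :=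
  \sum_(J : midx) f J * \prod_(k : 'I_m) x k (J k).

Definition tgrad (f : midx -> R) (k : 'I_m) (x : vecs) : 'I_(d k) -> R :=
  fun a => \sum_(J : midx | J k == a) f J * \prod_(l : 'I_m | l != k) x l (J l).

Definition Qf (f : midx -> R) (p : 'I_m -> R) (x : vecs) : R :=
  `|tform f x| / \prod_(k : 'I_m) lpnorm (p k) (x k).

Definition tnorm (f : midx -> R) (p : 'I_m -> R) : R :=
  sup [set Qf f p x | x in [set x : vecs | forall k, exists j, x k j != 0]].

Definition Qi (f : midx -> R) (p : 'I_m -> R) (i : 'I_m) (x : vecs) : R :=
  lpnorm (hconj (p i)) (tgrad f i x) / \prod_(k : 'I_m | k != i) lpnorm (p k) (x k).

(* S_{++}^{d-d_i}: positive points with unit p_k-norm components, k <> i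
   (the component x_i is irrelevant) *)
Definition Spp (p : 'I_m -> R) (i : 'I_m) : set vecs :=
  [set x | forall k, k != i -> (forall j, 0 < x k j) /\ lpnorm (p k) (x k) = 1].

(* equality of points of R^{d-d_i} = prod_{k<>i} R^{d_k} *)
Definition eq_off (i : 'I_m) (x y : vecs) : Prop :=
  forall k, k != i -> forall j, x k j = y k j.

Definition sik (f : midx -> R) (p : 'I_m -> R) (i k : 'I_m) (x : vecs) : 'I_(d k) -> R :=
  psi (hconj (p k))
    (tgrad f k (@dfwith _ (fun k => 'I_(d k) -> R) x i (psi (hconj (p i)) (tgrad f i x)))).

Definition gamma_minus (f : midx -> R) (p : 'I_m -> R) (i : 'I_m) (x : vecs) : R :=
  \prod_(k : 'I_m | k != i)
     inf (range (fun j : 'I_(d k) => (sik f p i k x j / x k j) `^ (p k - 1))).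

Definition gamma_plus (f : midx -> R) (p : 'I_m -> R) (i : 'I_m) (x : vecs) : R :=
  \prod_(k : 'I_m | k != i)
     sup (range (fun j : 'I_(d k) => (sik f p i k x j / x k j) `^ (p k - 1))).

Definition tnonneg (f : midx -> R) : Prop := forall J, 0 <= f J.

Definition wi_edge (f : midx -> R) : rel {k : 'I_m & 'I_(d k)} :=
  fun u v => (tag u != tag v) &&
    [exists J : midx, [&& J (tag u) == tagged u, J (tag v) == tagged v & 0 < f J]].

Definition weakly_irreducible (f : midx -> R) : Prop :=
  forall u v, connect (wi_edge f) u v.

End Tensor.

Arguments midx {m} d.
Arguments vecs {R m} d.
Arguments tform {R m d}.
Arguments tgrad {R m d}.
Arguments Qf {R m d}.
Arguments tnorm {R m d}.
Arguments Qi {R m d}.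
Arguments Spp {R m d}.
Arguments eq_off {R m d}.
Arguments sik {R m d}.
Arguments gamma_minus {R m d}.
Arguments gamma_plus {R m d}.
Arguments tnonneg {R m d}.
Arguments wi_edge {R m d}.
Arguments weakly_irreducible {R m d}.

(* Main.v *)
(* The hypothesis on p gives sum_k 1/p_k <= 1.  For positive z and nonnegative x,
   weighted AM-GM applied to every monomial of f with the ratios x/z yields
     f(x) <= f(z) * prod_k A_k^(1/p_k)
   as soon as the averages of (grad_k f(z))_j / z_kj^(p_k - 1), weighted by
   x_kj^p_k, are at most A_k f(z).  Completing z by z_i = psi(grad_i f(z)) makes
   these quotients constant for k = i and equal to the factors of gamma_i for
   k <> i, which is the upper bound.  Equality forces x^p / (z^p A) to be constant
   along the edges of the graph of f, hence x = z after normalisation.  The lower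
   bound holds because the average of the quotients with weights z_kj^p_k is
   ||grad_i f(z)||^p_i' <= ||f||^p_i'.  A maximizer exists by compactness and is
   positive by a perturbation argument. *)

Require Import Defs.
From HB Require Import structures.
From mathcomp Require Import all_boot all_order all_algebra.
From mathcomp Require Import all_classical all_reals all_analysis.
From mathcomp Require Import ring lra.
Import Order.TTheory GRing.Theory Num.Theory.
Local Open Scope ring_scope.
Local Open Scope classical_set_scope.
Import numFieldNormedType.Exports.

(** * Real powers and weighted AM-GM with its equality case *)

Section RealInequalities.
Context {R : realType}.
Implicit Types (p q r x y : R).

Lemma ler_powR_base r x y : 0 <= r -> 0 <= x -> x <= y -> x `^ r <= y `^ r.
Proof.
move=> r0 x0 xy; apply: ge0_ler_powR => //; rewrite nnegrE //.
exact: le_trans xy.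
Qed.

Lemma powR_inj_base r x y : 0 < r -> 0 <= x -> 0 <= y -> x `^ r = y `^ r -> x = y.
Proof. by move=> r0 x0 y0; apply: powR_injective; rewrite ?nnegrE. Qed.

Lemma powRrK r x : r != 0 -> 0 <= x -> (x `^ r) `^ r^-1 = x.
Proof. by move=> r0 x0; rewrite -powRrM divff// powRr1. Qed.

Lemma powRrVK r x : r != 0 -> 0 <= x -> (x `^ r^-1) `^ r = x.
Proof. by move=> r0 x0; rewrite -powRrM mulVf// powRr1. Qed.

Lemma powR_prod (I : Type) (s : seq I) (P : pred I) (F : I -> R) r :
  (forall k, P k -> 0 <= F k) ->
  (\prod_(k <- s | P k) F k) `^ r = \prod_(k <- s | P k) F k `^ r.
Proof.
move=> F0; have [] // : 0 <= \prod_(k <- s | P k) F k /\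
  (\prod_(k <- s | P k) F k) `^ r = \prod_(k <- s | P k) F k `^ r.
apply: (big_rec2 (fun a b => 0 <= a /\ a `^ r = b)); first by rewrite powR1.
by move=> k a b Pk [a0 <-]; rewrite mulr_ge0 ?F0// powRM ?F0.
Qed.

Lemma powR_sumr (I : Type) (s : seq I) (P : pred I) (w : I -> R) x : 0 < x ->
  x `^ (\sum_(k <- s | P k) w k) = \prod_(k <- s | P k) x `^ w k.
Proof.
move=> x0; elim/big_rec2: _ => [|k a b _ <-]; first by rewrite powRr0.
by rewrite powRD// (gt_eqF x0) implybT.
Qed.

Lemma ler_sum_eq (I : finType) (a b : I -> R) :
  (forall k, a k <= b k) -> \sum_k b k <= \sum_k a k -> forall k, a k = b k.
Proof.
move=> ab ba k; apply/eqP; rewrite eq_le ab /= -subr_le0.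
apply: le_trans (_ : \sum_k (b k - a k) <= 0); last by rewrite sumrB subr_le0.
rewrite (bigD1 k)//= lerDl; apply: sumr_ge0 => l _; by rewrite subr_ge0.
Qed.

Section WeightedAMGM.
Variables (I : finType) (w t : I -> R).
Hypotheses (w_gt0 : forall k, 0 < w k) (w_le1 : \sum_k w k <= 1).
Hypothesis t_ge0 : forall k, 0 <= t k.

(* Tangent lines of exp at the weighted mean of the logarithms; the missing
   weight 1 - sum w is put on the value 1. *)
Let tangent_le (L : R) k : 0 < t k ->
  w k * (expR L * (1 + (ln (t k) - L))) <= w k * t k ?= iff (ln (t k) == L).
Proof.
move=> tk0; rewrite -[X in _ <= w k * X ?= iff _](lnK tk0).
have -> : expR (ln (t k)) = expR L * expR (ln (t k) - L).
  by rewrite -expRD addrC subrK.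
split; first by rewrite ler_pM2l// ler_pM2l ?expR_gt0// expR_ge1Dx.
rewrite -subr_eq0 -mulrBr mulf_eq0 (gt_eqF (w_gt0 k)) /= -mulrBr mulf_eq0.
rewrite (gt_eqF (expR_gt0 _)) /= subr_eq0 -[RHS]subr_eq0.
apply/idP/idP => [/eqP e|/eqP ->]; last by rewrite expR0 addr0.
apply/negPn/negP => /expR_gt1Dx; by rewrite e ltxx.
Qed.

(** The linear terms of the tangent lines cancel because [L] is the mean of the logarithms; the last
    summand is the tangent line at log 1 = 0, carrying the missing weight. *)
Let wamgm_tangent (L := \sum_k w k * ln (t k)) : (forall k, 0 < t k) ->
  \prod_k t k `^ w k =
  \sum_k w k * (expR L * (1 + (ln (t k) - L)))
    + (1 - \sum_k w k) * (expR L * (1 - L)).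
Proof.
move=> t0.
have -> : \prod_k t k `^ w k = expR L.
  rewrite /L expR_sum; apply: eq_bigr => k _.
  by rewrite /powR (gt_eqF (t0 k)).
have -> : \sum_k w k * (expR L * (1 + (ln (t k) - L))) =
  expR L * ((1 - L) * \sum_k w k + L).
  rewrite mulr_sumr {3}/L -big_split /= mulr_sumr; apply: eq_bigr => k _; ring.
ring.
Qed.

Lemma wamgm : \prod_k t k `^ w k <= \sum_k w k * t k + (1 - \sum_k w k).
Proof.
have s0 : 0 <= 1 - \sum_k w k by rewrite subr_ge0.
have [|] := pselect (forall k, 0 < t k) => [t0|/existsNP[k /negP tk]].
  rewrite wamgm_tangent//; apply: lerD.
    by apply: ler_sum => k _; apply: tangent_le.
  rewrite -[leRHS]mulr1; apply: ler_wpM2l => //.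
  (* The remaining claim [expR L * (1 - L) <= 1] says that the tangent at [L] lies below exp at
     0. *)
  set L := \sum_k _; rewrite -[leRHS](expRxMexpNx_1 L).
  by rewrite ler_pM2l ?expR_gt0// expR_ge1Dx.
have tk0 : t k = 0 by apply/eqP; rewrite eq_le t_ge0 leNgt tk.
rewrite (bigD1 k)//= tk0 powR0 ?gt_eqF// mul0r addr_ge0//.
by apply: sumr_ge0 => l _; rewrite mulr_ge0// ltW.
Qed.

Lemma wamgm_eq : \sum_k w k * t k + (1 - \sum_k w k) <= \prod_k t k `^ w k ->
  forall k l, t k = t l.
Proof.
have s0 : 0 <= 1 - \sum_k w k by rewrite subr_ge0.
have [|] := pselect (forall k, 0 < t k) => [t0|/existsNP[k /negP tk]].
  rewrite wamgm_tangent//; set L := \sum_k w k * ln (t k) => le.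
  suff lnt k : ln (t k) = L by move=> k l; apply: ln_inj; rewrite ?posrE ?lnt.
  apply/eqP; rewrite -(tangent_le L k (t0 k)).2; apply/eqP.
  (* Once the missing-weight term is estimated, the sums of the tangent bounds agree, so each bound
     is tight. *)
  move: k; apply: ler_sum_eq => [k|]; first by apply: tangent_le.
  rewrite -(lerD2r (1 - \sum_k w k)); apply: (le_trans le).
  rewrite lerD2l -[leRHS]mulr1; apply: ler_wpM2l => //.
  rewrite -[leRHS](expRxMexpNx_1 L).
  by rewrite ler_pM2l ?expR_gt0// expR_ge1Dx.
(* A vanishing [t k] makes the product 0, so the nonnegative weighted sum is 0 and all [t l]
   vanish. *)
have tk0 : t k = 0 by apply/eqP; rewrite eq_le t_ge0 leNgt tk.
rewrite [X in _ <= X](bigD1 k)//= tk0 powR0 ?gt_eqF// mul0r => le.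
have wt0 l : 0 <= w l * t l by rewrite mulr_ge0// ltW.
suff z l : t l = 0 by move=> l l'; rewrite !z.
have /eqP : w l * t l = 0.
  apply/eqP; rewrite eq_le wt0 andbT; apply: le_trans le.
  rewrite (bigD1 l)//= -addrA lerDl addr_ge0//; exact: sumr_ge0.
by rewrite mulf_eq0 (gt_eqF (w_gt0 l)) => /eqP.
Qed.

End WeightedAMGM.

Lemma continuous_norm_powR p : 0 < p -> continuous (fun x : R => `|x| `^ p).
Proof.
move=> p0 x; have [->|x0] := eqVneq x 0.
  (* Differentiability may fail at 0, so the radius e^(1/p) is used directly. *)
  apply/cvgrPdist_lt => e e0; near=> y.
  rewrite normr0 powR0 ?gt_eqF// sub0r normrN ger0_norm ?powR_ge0//.
  rewrite -[ltRHS](@powRrVK p) ?gt_eqF ?ltW//.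
  apply: gt0_ltr_powR; rewrite ?nnegrE ?powR_ge0//.
  near: y; apply: (@nbhs0_lt _ R^o); exact: powR_gt0.
apply: (@continuous_comp _ _ _ (@Num.norm R R^o) (fun y : R => y `^ p) x).
  exact: norm_continuous.
apply: differentiable_continuous; apply/derivable1_diffP.
by apply: derivable_powR; rewrite in_itv /= normr_gt0 x0.
Unshelve. all: by end_near. Qed.

End RealInequalities.

(** * Conjugate exponents and extremal vectors in Hölder's inequality *)

Section ConjugateExponent.
Context {R : realType}.
Implicit Types p : R.

Lemma hconj_gt1 p : 1 < p -> 1 < hconj p.
Proof. by move=> p1; rewrite /hconj ltr_pdivlMr ?subr_gt0//; lra. Qed.

Lemma hconjB1 p : 1 < p -> hconj p - 1 = (p - 1)^-1.
Proof. by move=> p1; rewrite /hconj; field; rewrite subr_eq0 gt_eqF. Qed.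

Lemma hconjV p : 1 < p -> (hconj p)^-1 = 1 - p^-1.
Proof.
move=> p1; rewrite /hconj invf_div; field.
by rewrite gt_eqF//; apply: lt_trans p1.
Qed.

Lemma lpnorm_eq1 p n (y : 'I_n -> R) : 1 < p ->
  (lpnorm p y = 1) <-> (\sum_j `|y j| `^ p = 1).
Proof.
move=> p1; have p0 : 0 < p by apply: lt_trans p1.
rewrite /lpnorm; split => [e|->]; last by rewrite powR1.
rewrite -[LHS](@powRrVK _ p) ?gt_eqF ?e ?powR1//.
by apply: sumr_ge0 => j _; apply: powR_ge0.
Qed.

(** The dual vector of [h] is a competitor, so the maximum is at least the dual norm; summing
    Young's inequality gives the converse. Young is then tight in every coordinate, which determines
    [h] from [x]. *)
Lemma holder_extremal p n (h x : 'I_n -> R) : 1 < p ->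
  (forall j, 0 <= h j) -> (forall j, 0 <= x j) -> \sum_j x j `^ p = 1 ->
  (forall b : 'I_n -> R, (forall j, 0 <= b j) -> \sum_j b j `^ p = 1 ->
     \sum_j b j * h j <= \sum_j x j * h j) ->
  lpnorm (hconj p) h = \sum_j x j * h j /\
  forall j, h j = (\sum_j x j * h j) * x j `^ (p - 1).
Proof.
move=> p1 h0 x0 x1 hmax.
set q := hconj p; have q1 : 1 < q := hconj_gt1 _ p1.
have p0 : 0 < p by apply: lt_trans p1.
have q0 : 0 < q by apply: lt_trans q1.
have qV : q^-1 = 1 - p^-1 := hconjV _ p1.
have -> : lpnorm q h = (\sum_j h j `^ q) `^ q^-1.
  by rewrite /lpnorm; congr (_ `^ _); apply: eq_bigr => j _; rewrite ger0_norm.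
set S := \sum_j h j `^ q.
have S0 : 0 <= S by apply: sumr_ge0 => j _; apply: powR_ge0.
move: S0; rewrite le_eqVlt => /orP[/eqP S0|S0].
  have hz j : h j = 0.
    apply: (@powR_eq0_eq0 _ _ q).
    by apply: (@psumr_eq0P R _ xpredT (fun j => h j `^ q)) => // ? _; apply: powR_ge0.
  rewrite -S0 powR0 ?gt_eqF ?invr_gt0// big1 => [|j _]; last by rewrite hz mulr0.
  by split=> // j; rewrite hz mul0r.
set G := S `^ q^-1; have G0 : 0 < G by apply: powR_gt0.
have GS : G `^ q = S by rewrite /G powRrVK ?gt_eqF ?ltW.
(* Young's inequality is AM-GM on two points with weights 1/q and 1/p. *)
set t := fun j (b : bool) => if b then h j `^ q / S else x j `^ p.
set w := fun b : bool => if b then q^-1 else p^-1.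
have t0 j b : 0 <= t j b by case: b; rewrite /t ?divr_ge0 ?powR_ge0 ?ltW.
have w0 b : 0 < w b by case: b; rewrite /w invr_gt0.
have sw : \sum_b w b = 1 by rewrite big_bool /= qV subrK.
have tw j : \prod_b t j b `^ w b = x j * h j / G.
  rewrite big_bool /= powRM ?powR_ge0 ?invr_ge0 ?ltW// !powRrK ?gt_eqF//.
  rewrite -(powR_inv1 (ltW S0)) powRAC -/G (powR_inv1 (ltW G0)).
  by rewrite mulrC mulrA.
have young j : x j * h j / G <= q^-1 * (h j `^ q / S) + p^-1 * x j `^ p.
  have := @wamgm _ _ w (t j) w0 _ (t0 j); rewrite sw lexx => /(_ isT).
  by rewrite subrr addr0 tw big_bool.
have sumyoung : \sum_j (q^-1 * (h j `^ q / S) + p^-1 * x j `^ p) = 1.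
  rewrite big_split /= -!mulr_sumr x1 -mulr_suml -/S divff ?gt_eqF//.
  by rewrite !mulr1 qV subrK.
have GleH : G <= \sum_j x j * h j.
  (* The dual unit vector: [b] is proportional to h^(q-1), since q/p = q - 1. *)
  pose b j := (h j `^ q / S) `^ p^-1.
  have bp j : b j `^ p = h j `^ q / S.
    by rewrite /b powRrVK ?gt_eqF// divr_ge0 ?powR_ge0 ?ltW.
  have -> : G = \sum_j b j * h j.
    have e j : b j * h j = h j `^ q * S `^ (- p^-1).
      rewrite /b powRM ?powR_ge0 ?invr_ge0 ?ltW// -powRrM.
      rewrite -(powR_inv1 (ltW S0)) -powRrM mulN1r mulrAC; congr (_ * _).
      have -> : q * p^-1 = q - 1.
        rewrite -[p^-1](subKr 1) -qV mulrBr mulr1 mulfV//.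
        by rewrite gt_eqF.
      by rewrite mulrC mulr_powRB1.
    rewrite (eq_bigr _ (fun j _ => e j)) -mulr_suml -/S.
    rewrite -{1}(powRr1 (ltW S0)) -powRD ?(gt_eqF S0) ?implybT//.
    by rewrite /G qV.
  apply: (hmax b) => [j|]; first exact: powR_ge0.
  by rewrite (eq_bigr _ (fun j _ => bp j)) -mulr_suml divff// gt_eqF.
have HleG : \sum_j x j * h j <= G.
  rewrite -[leRHS]mul1r -ler_pdivrMr// mulr_suml -sumyoung.
  by apply: ler_sum => j _; apply: young.
have HG : \sum_j x j * h j = G by apply/eqP; rewrite eq_le HleG GleH.
rewrite HG; split=> // j.
have eqj : x j * h j / G = q^-1 * (h j `^ q / S) + p^-1 * x j `^ p.
  move: j; apply: ler_sum_eq => //.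
  by rewrite sumyoung -mulr_suml HG divff// gt_eqF.
have := @wamgm_eq _ _ w (t j) w0 _ (t0 j); rewrite sw lexx => /(_ isT).
rewrite subrr addr0 tw big_bool /= eqj lexx => /(_ isT true false) /= hx.
have -> : h j = (S * x j `^ p) `^ q^-1.
  by rewrite -hx mulrC divfK ?gt_eqF// powRrK// gt_eqF.
rewrite powRM ?powR_ge0 ?(ltW S0)// -/G -powRrM; congr (_ * _ `^ _).
by rewrite qV mulrBr mulr1 divff ?gt_eqF.
Qed.

End ConjugateExponent.

(** * The multilinear form and its partial gradients *)

Section TensorForm.
Context {R : realType} {m : nat} {d : 'I_m -> nat}.
Variable f : midx d -> R.
Implicit Types (x y z : vecs (R := R) d) (k l : 'I_m) (J : midx d).

(** Grouping the monomials by their k-th index turns averages over monomials, where AM-GM acts, into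
    averages over coordinates, where gradients appear. *)
Lemma tform_weighted k x (phi : 'I_(d k) -> R) :
  \sum_J (f J * \prod_l x l (J l)) * phi (J k) =
  \sum_a phi a * (x k a * tgrad f k x a).
Proof.
rewrite (partition_big (fun J : midx d => J k) xpredT)//=.
apply: eq_bigr => a _; rewrite /tgrad !mulr_sumr; apply: eq_bigr => J /eqP <-.
by rewrite (bigD1 k)//=; ring.
Qed.

Lemma tform_tgrad k x : tform f x = \sum_a x k a * tgrad f k x a.
Proof.
transitivity (\sum_J (f J * \prod_l x l (J l)) * 1).
  by apply: eq_bigr => J _; rewrite mulr1.
rewrite (tform_weighted k x (fun=> 1)).
by apply: eq_bigr => a _; rewrite mul1r.
Qed.

Lemma tgrad_eq k x y : (forall l, l != k -> forall j, x l j = y l j) ->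
  tgrad f k x = tgrad f k y.
Proof.
move=> xy; apply/funext => a; apply: eq_bigr => J _; congr (_ * _).
by apply: eq_bigr => l lk; apply: xy.
Qed.

Lemma tgrad_dfwith k x v : tgrad f k (@dfwith _ (fun k => 'I_(d k) -> R) x k v) = tgrad f k x.
Proof. by apply: tgrad_eq => l lk j; rewrite dfwithout// eq_sym. Qed.

Lemma tform_dfwith k x v :
  tform f (@dfwith _ (fun k => 'I_(d k) -> R) x k v) = \sum_a v a * tgrad f k x a.
Proof.
by rewrite (tform_tgrad k) tgrad_dfwith; apply: eq_bigr => a _; rewrite dfwithin.
Qed.

Hypothesis f_ge0 : tnonneg f.

Lemma tgrad_ge0 k x a : (forall l j, l != k -> 0 <= x l j) -> 0 <= tgrad f k x a.
Proof.
move=> x0; apply: sumr_ge0 => J _; apply: mulr_ge0; first exact: f_ge0.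
by apply: prodr_ge0 => l lk; apply: x0.
Qed.

(** * Comparison of the form at two points by AM-GM *)

Section HolderForm.
Variables (p A : 'I_m -> R) (x z : vecs (R := R) d).
Hypotheses (p_gt0 : forall k, 0 < p k) (pV_le1 : \sum_k (p k)^-1 <= 1).
Hypotheses (A_gt0 : forall k, 0 < A k).
Hypotheses (x_ge0 : forall k j, 0 <= x k j) (z_gt0 : forall k j, 0 < z k j).
Hypothesis avg_le : forall k,
  \sum_j x k j `^ p k * (tgrad f k z j / z k j `^ (p k - 1)) <= A k * tform f z.

(** [T] compares the masses x^p with z^p, discounted by [A]. [W J] is the monomial at [z], [P]
    collects the discounts, and [B J] is the AM-GM bound for the geometric mean of the
    [T k (J k)]. *)
Let T k j := x k j `^ p k / (z k j `^ p k * A k).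
Let W J := f J * \prod_k z k (J k).
Let P := \prod_k A k `^ (p k)^-1.
Let B J := \sum_k (p k)^-1 * T k (J k) + (1 - \sum_k (p k)^-1).

Let T_ge0 k j : 0 <= T k j.
Proof. by rewrite divr_ge0 ?mulr_ge0 ?powR_ge0 ?ltW. Qed.

Let P_gt0 : 0 < P.
Proof. by apply: prodr_gt0 => k _; apply: powR_gt0. Qed.

Let termE J : f J * \prod_k x k (J k) =
  P * (W J * \prod_k T k (J k) `^ (p k)^-1).
Proof.
rewrite /P /W mulrCA -mulrA -!big_split /=; congr (_ * _); apply: eq_bigr => k _.
rewrite /T invfM mulrA -{1}(@powRrK _ (p k) (x k (J k))) ?gt_eqF//.
rewrite -{1}(@powRrK _ (p k) (z k (J k))) ?gt_eqF ?ltW//.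
rewrite -!powRM ?mulr_ge0 ?powR_ge0 ?invr_ge0 ?ltW ?powR_gt0//.
congr (_ `^ _); field; rewrite gt_eqF//= gt_eqF// powR_gt0//.
Qed.

Let term_le J : f J * \prod_k x k (J k) <= P * (W J * B J).
Proof.
rewrite termE ler_pM2l//; apply: ler_wpM2l.
  by rewrite mulr_ge0 ?f_ge0// prodr_ge0// => k _; rewrite ltW.
by apply: wamgm => // k; rewrite invr_gt0.
Qed.

(** By [avg_le], the [W]-weighted sum of each [T k] is at most f(z), so every weight 1/p_k costs at
    most its own share of f(z). *)
Let sum_bound_le : \sum_J P * (W J * B J) <= P * tform f z.
Proof.
rewrite -mulr_sumr ler_pM2l//.
have -> : \sum_J W J * B J = \sum_k (p k)^-1 * (\sum_J W J * T k (J k))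
   + (1 - \sum_k (p k)^-1) * tform f z.
  under eq_bigr do rewrite mulrDr.
  rewrite big_split /= -mulr_suml [X in _ + X]mulrC; congr (_ + _).
  under eq_bigr do rewrite mulr_sumr.
  rewrite exchange_big /=; apply: eq_bigr => k _; rewrite mulr_sumr.
  by apply: eq_bigr => J _; rewrite mulrCA.
rewrite mulrBl mul1r addrCA gerDl subr_le0 mulr_suml.
apply: ler_sum => k _; rewrite ler_pM2l ?invr_gt0//.
rewrite tform_weighted -(ler_pM2l (A_gt0 k)); apply: le_trans (avg_le k).
rewrite mulr_sumr le_eqVlt; apply/orP; left; apply/eqP; apply: eq_bigr => j _.
rewrite /T -(@mulr_powRB1 _ (z k j) (p k)) ?ltW//; field.
by rewrite !gt_eqF ?powR_gt0.
Qed.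

Lemma tform_holder : tform f x <= tform f z * P.
Proof.
rewrite mulrC; apply: le_trans sum_bound_le; apply: ler_sum => J _; exact: term_le.
Qed.

(** Equal sums force equality in AM-GM for every monomial; a positive coefficient allows cancelling
    [W J]. *)
Lemma tform_holder_eq : tform f z * P <= tform f x ->
  forall J, 0 < f J -> forall k l, T k (J k) = T l (J l).
Proof.
move=> le J fJ.
have : f J * \prod_k x k (J k) = P * (W J * B J).
  move: J {fJ}; apply: ler_sum_eq => //.
  by apply: le_trans sum_bound_le _; rewrite mulrC.
rewrite termE => /(mulfI (lt0r_neq0 P_gt0)).
have WJ : W J != 0.
  by rewrite mulf_neq0 ?gt_eqF// prodr_gt0// => k _.
move=> /(mulfI WJ) e; apply: (@wamgm_eq _ _ (fun k => (p k)^-1) (fun k => T k (J k))) => //.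
  by move=> k; rewrite invr_gt0.
by rewrite e.
Qed.

End HolderForm.

End TensorForm.

Lemma connect_invariant (T : finType) (e : rel T) (P : T -> Prop) :
  (forall u v, e u v -> P u -> P v) -> forall u v, connect e u v -> P u -> P v.
Proof.
move=> eP u v /connectP[s]; elim: s u => [|w s IH] u /=; first by move=> _ ->.
by case/andP => uw ws vE Pu; apply: (IH w) => //; apply: eP Pu.
Qed.

Lemma continuous_sumr {R : realType} (X : topologicalType) (I : finType)
    (F : I -> X -> R) :
  (forall a, continuous (F a)) -> continuous (fun u => \sum_a F a u).
Proof. by move=> cF; apply: continuous_big => //; exact: add_continuous. Qed.

Lemma continuous_tform {R : realType} {m : nat} {d : 'I_m -> nat}
    (f : midx d -> R) (X : topologicalType) (v : X -> vecs (R := R) d) :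
  (forall k j, continuous (fun u => v u k j)) ->
  continuous (fun u => tform f (v u)).
Proof.
move=> cv; apply: (continuous_sumr X _ (fun J u => f J * \prod_k v u k (J k))) => J u.
have cp : continuous (fun u : X => \prod_k v u k (J k)).
  by apply: continuous_big => //; exact: mul_continuous.
exact: (cvgM (cvg_cst (f J)) (cp u)).
Qed.

(** * Existence and positivity of a maximizer *)

Section Maximizer.
Context {R : realType} {m : nat} {d : 'I_m -> nat}.
Variables (f : midx d -> R) (p : 'I_m -> R).
Implicit Types (x y z : vecs (R := R) d) (k l : 'I_m) (J : midx d).

Definition unit_orthant x :=
  (forall k j, 0 <= x k j) /\ forall k, \sum_j x k j `^ p k = 1.

Definition form_maximizer x :=
  unit_orthant x /\ forall y, unit_orthant y -> tform f y <= tform f x.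

Hypothesis d_gt0 : forall k, (0 < d k)%N.
Hypothesis p_gt1 : forall k, 1 < p k.

Let p_gt0 k : 0 < p k. Proof. exact: lt_trans (p_gt1 k). Qed.

(** Points are flattened to functions on the finite set of all coordinates, so that Tychonoff's
    theorem applies. *)
Let K : finType := {k : 'I_m & 'I_(d k)}.
Let X : topologicalType := prod_topology (fun _ : K => R : topologicalType).
Let vec_of (u : X) : vecs (R := R) d := fun k j => u (Tagged (fun k => 'I_(d k)) j).

Let continuous_coord (v : K) : continuous (fun u : X => u v).
Proof. exact: (@proj_continuous _ (fun _ : K => R : topologicalType) v). Qed.

Let compact_orthant : compact [set u : X | unit_orthant (vec_of u)].
Proof.
(* A closed part of a cube; the absolute values make the constraint continuous on the whole space
   and change nothing on the cube. *)
have -> : [set u : X | unit_orthant (vec_of u)] =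
  [set u : X | forall v, `[0 : R, 1]%classic (u v)] `&`
  \bigcap_k (fun u : X => \sum_j `|vec_of u k j| `^ p k) @^-1` [set 1].
  apply/seteqP; split => [u [u0 u1]|u [u0 u1]].
    split => [[k j]|k _] /=.
      rewrite in_itv /= -/(vec_of u k j) u0 /=.
      rewrite -[leLHS](@powRrK _ (p k)) ?gt_eqF//.
      rewrite [leRHS](_ : 1 = 1 `^ (p k)^-1); last by rewrite powR1.
      apply: ler_powR_base; rewrite ?powR_ge0 ?invr_ge0 ?(ltW (p_gt0 k))// -(u1 k).
      rewrite (bigD1 j)//= lerDl; apply: sumr_ge0 => l _; exact: powR_ge0.
    by rewrite -[RHS](u1 k); apply: eq_bigr => j _; rewrite ger0_norm.
  have u0' k j : 0 <= vec_of u k j.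
    by have /= := u0 (Tagged _ j); rewrite in_itv /= => /andP[].
  split => // k; rewrite -[RHS](u1 k I).
  by apply: eq_bigr => j _; rewrite ger0_norm.
apply: compact_closedI.
  by apply: (@tychonoff K (fun=> R) (fun=> `[0 : R, 1]%classic)) => _;
    apply: segment_compact.
apply: closed_bigI => k _; apply: preimage_closed; last exact: closed_eq.
move=> u _; apply: (continuous_sumr X _ (fun j u => `|vec_of u k j| `^ p k)) => j {}u.
apply: (@continuous_comp _ _ _ (fun u : X => vec_of u k j) (fun t : R => `|t| `^ p k)).
  exact: continuous_coord.
exact: continuous_norm_powR.
Qed.

Lemma form_maximizer_exists : exists x, form_maximizer x.
Proof.
have ne : [set u : X | unit_orthant (vec_of u)] !=set0.
  (* Uniform masses 1/d_k. *)
  exists (fun v => ((d (tag v))%:R^-1) `^ (p (tag v))^-1); split => k.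
    by move=> j; apply: powR_ge0.
  rewrite /vec_of /= sumr_const card_ord powRrVK ?gt_eqF ?invr_ge0//.
  by rewrite -[_ *+ _]mulr_natr mulVf// pnatr_eq0 -lt0n.
have [u] := compact_EVT_max ne compact_orthant
  (continuous_subspaceT (continuous_tform f X vec_of
    (fun k j => continuous_coord _))).
rewrite inE => uU umax; exists (vec_of u); split=> // y yU.
have := umax (fun v : K => y (tag v) (tagged v)); apply; rewrite inE; exact: yU.
Qed.

Hypothesis f_ge0 : tnonneg f.

(** The supremum ranges over signed, unnormalised vectors. With nonnegative coefficients, absolute
    values do not decrease |f|, and scaling the blocks leaves the quotient unchanged. *)
Lemma tnorm_maximizer x : form_maximizer x -> tnorm f p = tform f x.
Proof.
move=> [[x0 x1] xmax].
have prod0 y J : (forall k j, 0 <= y k j) -> 0 <= f J * \prod_k y k (J k).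
  by move=> y0; rewrite mulr_ge0 ?f_ge0// prodr_ge0.
have H0 : 0 <= tform f x by apply: sumr_ge0 => J _; apply: prod0.
have N1 k : lpnorm (p k) (x k) = 1.
  apply/lpnorm_eq1 => //; rewrite -[RHS](x1 k).
  by apply: eq_bigr => j _; rewrite ger0_norm.
have xin : [set Qf f p x | x in [set x : vecs d | forall k, exists j, x k j != 0]]
    (tform f x).
  exists x => /=; last by rewrite /Qf ger0_norm// big1 ?divr1.
  move=> k; apply: contrapT => /forallNP x0k; have /eqP := x1 k.
  rewrite big1 ?(eq_sym 0) ?oner_eq0// => j _; have /negP := x0k j.
  by rewrite negbK => /eqP ->; rewrite powR0 ?gt_eqF.
have ub : ubound [set Qf f p x | x in [set x : vecs d | forall k, exists j, x k j != 0]]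
    (tform f x).
  move=> _ [y /= y0 <-]; rewrite /Qf.
  have S0 k : 0 < \sum_j `|y k j| `^ p k.
    have [j yj] := y0 k; rewrite (bigD1 j)//= ltr_pwDl ?powR_gt0 ?normr_gt0//.
    by apply: sumr_ge0 => l _; apply: powR_ge0.
  have L0 k : 0 < lpnorm (p k) (y k) by apply: powR_gt0.
  rewrite ler_pdivrMr; last by apply: prodr_gt0.
  pose y' : vecs d := fun k j => `|y k j| / lpnorm (p k) (y k).
  have y'U : unit_orthant y'.
    split=> k; first by move=> j; rewrite /y' divr_ge0 ?(ltW (L0 k)).
    have e j : y' k j `^ p k = `|y k j| `^ p k / (\sum_j `|y k j| `^ p k).
      rewrite powRM ?invr_ge0 ?(ltW (L0 k))//; congr (_ * _).
      rewrite -(powR_inv1 (ltW (L0 k))) powRAC /lpnorm powRrVK ?gt_eqF ?ltW//.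
      by rewrite powR_inv1 ?(ltW (S0 k)).
    by rewrite (eq_bigr _ (fun j _ => e j)) -mulr_suml mulfV ?(lt0r_neq0 (S0 k)).
  apply: le_trans (ler_wpM2r _ (xmax _ y'U)); last first.
    by apply: prodr_ge0 => k _; apply: ltW.
  apply: le_trans (ler_norm_sum _ _ _) _; rewrite mulr_suml.
  apply: ler_sum => J _; rewrite normrM ger0_norm ?f_ge0// -mulrA -big_split /=.
  rewrite normr_prod; apply: ler_wpM2l; first exact: f_ge0.
  apply: ler_prod => k _; rewrite normr_ge0 /= /y' divfK//.
  by rewrite gt_eqF.
apply/eqP; rewrite eq_le; apply/andP; split.
  by apply: ge_sup => //; exists (tform f x).
by apply: ub_le_sup => //; exists (tform f x).
Qed.

Hypothesis f_irr : weakly_irreducible f.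
Hypothesis pV_le1 : \sum_k (p k)^-1 <= 1.

(* Moving the masses x^p by t towards the uniform ones costs at most t * f(x),
   but a zero entry adjacent to a positive one yields a gain c * t^s, s < 1. *)
Lemma form_maximizer_gt0 x : form_maximizer x -> forall k j, 0 < x k j.
Proof.
move=> [[x0 x1] xmax].
set H := tform f x.
have H0 : 0 <= H.
  by apply: sumr_ge0 => J _; rewrite mulr_ge0 ?f_ge0// prodr_ge0.
(* Unit mass gives a positive entry in each block; connectivity spreads positivity from it. *)
suff edge (u v : {k : 'I_m & 'I_(d k)}) : wi_edge f u v ->
    0 < x (tag u) (tagged u) -> 0 < x (tag v) (tagged v).
  move=> k j.
  have [j0 /andP[_ xj0]] : exists j0 : 'I_(d k), true && (0 < x k j0 `^ p k).
    apply: psumr_neq0P => [j0 _|]; first exact: powR_ge0.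
    by rewrite x1; apply/eqP; rewrite oner_eq0.
  apply: (connect_invariant _ _ (fun v => 0 < x (tag v) (tagged v)) edge
    (Tagged _ j0) (Tagged _ j)); first exact: f_irr.
  exact: (@gt0_powR _ _ (p k)).
case/andP => uv /existsP[J /and3P[/eqP Ju /eqP Jv fJ]] xu.
rewrite lt_neqAle x0 andbT; apply/eqP => xv.
(* Omitting the positive term 1/p_k0 makes the exponent [a] strictly less than 1. *)
set k0 := tag u; set a := \sum_(k | k != k0) (p k)^-1.
have a1 : 0 < 1 - a.
  rewrite subr_gt0; apply: lt_le_trans pV_le1.
  by rewrite (bigD1 k0)//= -/a ltrDr invr_gt0.
(* Below, [c * t^a] bounds the monomial [J] at the perturbed point: block k0 keeps at least half its
   mass, every other block has at least the uniform share t/d_k. *)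
pose c := f J * ((2^-1 `^ (p k0)^-1 * x k0 (J k0)) *
  \prod_(k | k != k0) ((d k)%:R^-1) `^ (p k)^-1).
have dV0 k : 0 < (d k)%:R^-1 :> R by rewrite invr_gt0 ltr0n.
have c0 : 0 < c.
  rewrite /c !mulr_gt0 ?powR_gt0//; first by rewrite Ju.
  by apply: prodr_gt0 => k _; apply: powR_gt0.
have gain t : 0 < t -> t <= 2^-1 -> (1 - t) * H + c * t `^ a <= H.
  move=> t0 t2; have s0 : 0 < 1 - t by lra.
  pose y : vecs d := fun k j =>
    ((1 - t) * x k j `^ p k + t * (d k)%:R^-1) `^ (p k)^-1.
  have yU : unit_orthant y.
    split=> k; first by move=> j; apply: powR_ge0.
    have e j : y k j `^ p k = (1 - t) * x k j `^ p k + t * (d k)%:R^-1.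
      by rewrite powRrVK ?gt_eqF// addr_ge0 ?mulr_ge0 ?powR_ge0 ?ltW.
    rewrite (eq_bigr _ (fun j _ => e j)) big_split /= -mulr_sumr x1.
    rewrite sumr_const card_ord -[_ *+ _]mulr_natr -mulrA mulVf ?pnatr_eq0 -?lt0n//.
    by rewrite !mulr1 subrK.
  have ylb1 k j : (1 - t) `^ (p k)^-1 * x k j <= y k j.
    rewrite -{1}(@powRrK _ (p k) (x k j)) ?gt_eqF// -powRM ?powR_ge0 ?(ltW s0)//.
    apply: ler_powR_base.
    - by rewrite invr_ge0 ltW.
    - by rewrite mulr_ge0 ?powR_ge0 ?(ltW s0).
    by rewrite lerDl mulr_ge0 ?ltW.
  have ylb2 k j : t `^ (p k)^-1 * ((d k)%:R^-1) `^ (p k)^-1 <= y k j.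
    rewrite -powRM ?(ltW t0) ?(ltW (dV0 k))//.
    apply: ler_powR_base.
    - by rewrite invr_ge0 ltW.
    - by rewrite mulr_ge0 ?(ltW t0) ?(ltW (dV0 k)).
    by rewrite lerDr mulr_ge0 ?powR_ge0 ?ltW.
  apply: le_trans (xmax _ yU).
  (* The monomial [J] contributes nothing at [x], as its factor at [v] is 0. *)
  have HE : H = \sum_(J' | J' != J) f J' * \prod_k x k (J' k).
    rewrite /H /tform (bigD1 J)//= (bigD1 (tag v))//= Jv -xv.
    by rewrite mul0r mulr0 add0r.
  rewrite /tform (bigD1 J)//= addrC; apply: lerD; last first.
    rewrite /c -[leLHS]mulrA; apply: ler_wpM2l; first exact: f_ge0.
    rewrite [leRHS](bigD1 k0)//= -[leLHS]mulrA; apply: ler_pM.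
    - by rewrite mulr_ge0 ?powR_ge0.
    - by rewrite mulr_ge0 ?powR_ge0// prodr_ge0// => k _; apply: powR_ge0.
    - apply: le_trans (ylb1 _ _); apply: ler_wpM2r => //.
      by apply: ler_powR_base; rewrite ?invr_ge0 ?(ltW (p_gt0 _))//; lra.
    - rewrite mulrC /a powR_sumr// -big_split /=; apply: ler_prod => k _.
      by rewrite ylb2 mulr_ge0 ?powR_ge0.
  (* The other monomials keep a factor (1-t)^(sum 1/p_k), at least 1 - t because the exponent is at
     most 1. *)
  apply: (@le_trans _ _ ((1 - t) `^ (\sum_k (p k)^-1) * H)).
    by apply: ler_wpM2r => //; apply: ger1_powR; rewrite ?s0//=; lra.
  rewrite HE mulr_sumr; apply: ler_sum => J' _; rewrite powR_sumr// mulrCA.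
  apply: ler_wpM2l; first exact: f_ge0.
  rewrite -big_split /=; apply: ler_prod => k _.
  by rewrite ylb1 mulr_ge0 ?powR_ge0.
(* This gives t^(1-a) (H+1) <= c, so the gain c t^a is at least t (H+1), more than the loss t H. *)
pose t := Num.min 2^-1 ((c / (H + 1)) `^ (1 - a)^-1).
have H1 : 0 < H + 1 by lra.
have t0 : 0 < t by rewrite lt_min invr_gt0 ltr0n /= powR_gt0// divr_gt0.
have t2 : t <= 2^-1 by rewrite ge_min lexx.
have := gain t t0 t2; apply/negP; rewrite -ltNge.
have : t `^ (1 - a) <= c / (H + 1).
  rewrite -[leRHS](@powRrVK _ (1 - a)) ?gt_eqF ?divr_ge0 ?(ltW c0) ?(ltW H1)//.
  by apply: ler_powR_base; [exact: ltW|exact: ltW|rewrite ge_min lexx orbT].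
rewrite ler_pdivlMr// => le.
have tE : t = t `^ a * t `^ (1 - a).
  by rewrite -powRD ?(gt_eqF t0) ?implybT// subrKC powRr1 ?ltW.
rewrite mulrBl mul1r -addrA ltrDl addrC subr_gt0 {1}tE -mulrA mulrC.
rewrite ltr_pM2r ?powR_gt0//; apply: lt_le_trans le.
by rewrite ltr_pM2l ?powR_gt0// ltrDl.
Qed.

Lemma form_maximizer_Spp i x : form_maximizer x -> Spp p i x.
Proof.
move=> xM k _; have x0 := form_maximizer_gt0 x xM; split=> //.
apply/lpnorm_eq1 => //; rewrite -[RHS](xM.1.2 k).
by apply: eq_bigr => j _; rewrite gtr0_norm.
Qed.

End Maximizer.

(** * Suprema and infima of finitely many values *)

Section FiniteRange.
Context {R : realType} {n : nat}.
Implicit Types g : 'I_n -> R.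

Lemma le_sup_range g j : g j <= sup (range g).
Proof.
apply: ub_le_sup; last by exists j.
exists (\sum_a `|g a|) => _ [a _ <-]; apply: le_trans (ler_norm _) _.
by rewrite (bigD1 a)//= lerDl; apply: sumr_ge0.
Qed.

Lemma sup_range_le g c : (0 < n)%N -> (forall j, g j <= c) -> sup (range g) <= c.
Proof.
move=> n0 gc; apply: ge_sup; first by exists (g (Ordinal n0)); exists (Ordinal n0).
by move=> _ [a _ <-].
Qed.

Lemma inf_range_le g j : inf (range g) <= g j.
Proof.
apply: ge_inf; last by exists j.
exists (- \sum_a `|g a|) => _ [a _ <-]; rewrite lerNl.
apply: le_trans (ler_norm _) _; rewrite normrN.
by rewrite (bigD1 a)//= lerDl; apply: sumr_ge0.
Qed.

Lemma le_inf_range g c : (0 < n)%N -> (forall j, c <= g j) -> c <= inf (range g).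
Proof.
move=> n0 gc; apply: lb_le_inf; first by exists (g (Ordinal n0)); exists (Ordinal n0).
by move=> _ [a _ <-].
Qed.

End FiniteRange.

(** * The two bounds and their equality cases *)

Section PerronFrobenius.
Context {R : realType} {m : nat} {d : 'I_m -> nat}.
Variables (f : midx d -> R) (p : 'I_m -> R) (i : 'I_m).
Implicit Types (x y z : vecs (R := R) d) (k l : 'I_m) (J : midx d).
Hypothesis d_gt0 : forall k, (0 < d k)%N.
Hypothesis f_ge0 : tnonneg f.
Hypothesis f_irr : weakly_irreducible f.
Hypothesis p_gt1 : forall k, 1 < p k.
Hypothesis p_large : forall k, k != i -> (m - 1)%:R * hconj (p i) <= p k.

Let p_gt0 k : 0 < p k. Proof. exact: lt_trans (p_gt1 k). Qed.
Let q := hconj (p i).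
Let q_gt1 : 1 < q. Proof. exact: hconj_gt1. Qed.
Let q_gt0 : 0 < q. Proof. exact: lt_trans q_gt1. Qed.
Let qVE : q^-1 = 1 - (p i)^-1. Proof. exact: hconjV. Qed.
Let n : R := (m - 1)%:R.

Let n_gt0 k : k != i -> 0 < n.
Proof.
move=> ki; rewrite ltr0n subn_gt0 ltnNge; apply: contra ki => m1.
move: (ltn_ord k) (ltn_ord i) => km im; apply/eqP/val_inj => /=.
by move: (leq_trans km m1) (leq_trans im m1); rewrite !ltnS !leqn0 => /eqP -> /eqP ->.
Qed.

Let pV_le k : k != i -> (p k)^-1 <= (n * q)^-1.
Proof.
move=> ki; rewrite lef_pV2; first exact: p_large; rewrite posrE//.
by rewrite mulr_gt0// (n_gt0 k).
Qed.

Let card_off : #|[pred k | k != i]| = (m - 1)%N.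
Proof. by rewrite subn1 -[in RHS](card_ord m) -(cardC1 i); apply: eq_card. Qed.

(** The m - 1 exponents other than p_i contribute at most 1/(n q) each, hence at most 1/q = 1 -
    1/p_i together. *)
Lemma sum_pV_le1 : \sum_k (p k)^-1 <= 1.
Proof.
rewrite (bigD1 i)//= -lerBrDl -qVE.
apply: (@le_trans _ _ (\sum_(k | k != i) (n * q)^-1)).
  by apply: ler_sum => k; apply: pV_le.
rewrite sumr_const card_off -[_ *+ _]mulr_natr -/n.
(* For m = 1, [n] is 0 and cannot be cancelled; the sum is then 0. *)
have [->|n0] := eqVneq n 0; first by rewrite mulr0 invr_ge0 ltW.
by rewrite invfM mulrAC mulVf// mul1r.
Qed.

(** Varying only block k leaves a linear maximisation over the unit sphere, to which
    [holder_extremal] applies; the result is the Euler-Lagrange system. *)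
Lemma form_maximizer_critical x (xM : form_maximizer f p x) k :
  lpnorm (hconj (p k)) (tgrad f k x) = tform f x /\
  forall j, tgrad f k x j = tform f x * x k j `^ (p k - 1).
Proof.
have [[x0 x1] xmax] := xM.
rewrite (tform_tgrad f k x); apply: holder_extremal => //.
- by move=> j; apply: tgrad_ge0.
- move=> b b0 b1; rewrite -tform_tgrad -tform_dfwith; apply: xmax; split=> l.
    by move=> j; case: dfwithP j => //.
  by case: dfwithP => //.
Qed.

Hypothesis m_gt1 : (1 < m)%N.

Let n0 : 0 < n. Proof. by rewrite ltr0n subn_gt0. Qed.
Let nq0 : 0 < n * q. Proof. exact: mulr_gt0. Qed.

(** Otherwise (k, a) would be an isolated vertex, although m > 1 provides a vertex in another
    block. *)
Lemma exists_tensor_index k (a : 'I_(d k)) : exists J : midx d, J k = a /\ 0 < f J.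
Proof.
have [l lk] : exists l, l != k.
  apply/existsP; rewrite -(negbK [exists _, _]) negb_exists; apply/negP.
  move=> /forallP nl; have : (#|'I_m| <= 1)%N.
    by apply/fintype_le1P => u v; have := nl u; have := nl v; rewrite !negbK => /eqP -> /eqP ->.
  by rewrite card_ord leqNgt m_gt1.
apply: contrapT => /forallNP nJ.
pose u : {k : 'I_m & 'I_(d k)} := Tagged (fun k => 'I_(d k)) a.
have stuck w v : wi_edge f w v -> w = u -> v = u.
  move=> + wu; rewrite wu => /andP[_ /existsP[J /and3P[/eqP Ju _ fJ]]].
  by case: (nJ J); split=> //; exact: Ju.
have := connect_invariant _ _ (fun v => v = u) stuck u
  (Tagged (fun k => 'I_(d k)) (Ordinal (d_gt0 l))) (f_irr _ _) erefl.
by move/(congr1 tag) => /= e; move: lk; rewrite e eqxx.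
Qed.

Lemma tgrad_gt0 k z a : (forall l j, l != k -> 0 < z l j) -> 0 < tgrad f k z a.
Proof.
move=> z0; have [J [Jk fJ]] := exists_tensor_index k a.
rewrite /tgrad (bigD1 J) ?Jk//= ltr_pwDl//.
  by rewrite mulr_gt0// prodr_gt0// => l lk; apply: z0.
apply: sumr_ge0 => J' _; rewrite mulr_ge0 ?f_ge0//.
by apply: prodr_ge0 => l lk; rewrite ltW// z0.
Qed.

(* The i-th component is filled in with the optimal direction, up to scaling,
   for the remaining ones. *)
Let ext z : vecs d :=
  @dfwith _ (fun k => 'I_(d k) -> R) z i (psi q (tgrad f i z)).
(** For positive [z] this is the q-th power of the dual norm of the i-th gradient. *)
Let F z : R := \sum_a tgrad f i z a `^ q.
Let ratio z k j : R := tgrad f k (ext z) j / z k j `^ (p k - 1).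

Let off_gt0 z := forall k j, k != i -> 0 < z k j.

Let ext_i z j : off_gt0 z -> ext z i j = tgrad f i z j `^ (q - 1).
Proof.
move=> z0; rewrite /ext dfwithin /psi.
have g0 : 0 < tgrad f i z j by apply: tgrad_gt0 => l l' /z0.
by rewrite gtr0_sg// gtr0_norm// mul1r.
Qed.

Let ext_off z k : k != i -> ext z k = z k.
Proof. by move=> ki; rewrite /ext dfwithout// eq_sym. Qed.

Let ext_gt0 z : off_gt0 z -> forall k j, 0 < ext z k j.
Proof.
move=> z0 k j; have [ki|ki] := eqVneq k i; last by rewrite ext_off// z0.
move: j; rewrite ki => j; rewrite ext_i// powR_gt0//.
by apply: tgrad_gt0 => l l' /z0.
Qed.

Let tform_ext z : off_gt0 z -> tform f (ext z) = F z.
Proof.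
move=> z0; rewrite (tform_tgrad f i) /F; apply: eq_bigr => a _.
rewrite ext_i// /ext tgrad_dfwith mulrC mulr_powRB1// ltW//.
by apply: tgrad_gt0 => l l' /z0.
Qed.

Let F_gt0 z : off_gt0 z -> 0 < F z.
Proof.
move=> z0; rewrite /F (bigD1 (Ordinal (d_gt0 i)))//= ltr_pwDl//.
  by rewrite powR_gt0//; apply: tgrad_gt0 => l l' /z0.
by apply: sumr_ge0 => a _; apply: powR_ge0.
Qed.

Let ratio_gt0 z k j : off_gt0 z -> k != i -> 0 < ratio z k j.
Proof.
move=> z0 ki; rewrite divr_gt0 ?powR_gt0 ?z0//.
by apply: tgrad_gt0 => l l' _; apply: ext_gt0.
Qed.

(** The map [psi] with conjugate exponent raises to the power 1/(p_k - 1), which the outer power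
    undoes. *)
Let sik_ratio z k j : off_gt0 z -> k != i ->
  (sik f p i k z j / z k j) `^ (p k - 1) = ratio z k j.
Proof.
move=> z0 ki; rewrite /sik -/q -/(ext z) /psi hconjB1//.
have h0 : 0 < tgrad f k (ext z) j by apply: tgrad_gt0 => l l' _; apply: ext_gt0.
have pk1 : p k - 1 != 0 by rewrite subr_eq0 gt_eqF.
rewrite gtr0_sg// gtr0_norm// mul1r powRM ?powR_ge0 ?invr_ge0 ?(ltW (z0 k j ki))//.
rewrite powRrVK ?(ltW h0)// -(powR_inv1 (ltW (z0 k j ki))) powRAC.
by rewrite powR_inv1// powR_ge0.
Qed.

Let gamma_plusE z : off_gt0 z ->
  gamma_plus f p i z = \prod_(k | k != i) sup (range (ratio z k)).
Proof.
move=> z0; apply: eq_bigr => k ki; apply: (congr1 (fun g : 'I_(d k) -> R => sup (range g))).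
apply/funext => j; rewrite /=.
exact: sik_ratio.
Qed.

Let gamma_minusE z : off_gt0 z ->
  gamma_minus f p i z = \prod_(k | k != i) inf (range (ratio z k)).
Proof.
move=> z0; apply: eq_bigr => k ki; apply: (congr1 (fun g : 'I_(d k) -> R => inf (range g))).
apply/funext => j; rewrite /=.
exact: sik_ratio.
Qed.

Let Spp_gt0 z : Spp p i z -> off_gt0 z.
Proof. by move=> zS k j ki; have [+ _] := zS k ki; apply. Qed.

Let Spp_unit z k : Spp p i z -> k != i -> \sum_j z k j `^ p k = 1.
Proof.
move=> zS ki; have [z0 /lpnorm_eq1 z1] := zS k ki; rewrite -[RHS](z1 (p_gt1 k)).
by apply: eq_bigr => j _; rewrite gtr0_norm.
Qed.

(** Expanding f(ext z) along block k exhibits [F z] as a mean of the quotients with probability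
    weights z^p_k, so it lies between their extremes. *)
Let ratio_avg z k : Spp p i z -> k != i ->
  \sum_j z k j `^ p k * ratio z k j = F z.
Proof.
move=> zS ki; have z0 := Spp_gt0 _ zS.
rewrite -tform_ext// (tform_tgrad f k); apply: eq_bigr => j _.
rewrite ext_off// /ratio -(@mulr_powRB1 _ (z k j) (p k)) ?ltW ?z0//.
by field; rewrite gt_eqF// powR_gt0// z0.
Qed.

Let F_le_sup z k : Spp p i z -> k != i -> F z <= sup (range (ratio z k)).
Proof.
move=> zS ki; rewrite -(ratio_avg z k)// -[leRHS]mul1r -(Spp_unit z k)// mulr_suml.
by apply: ler_sum => j _; apply: ler_wpM2l; rewrite ?powR_ge0 ?le_sup_range.
Qed.

Let inf_le_F z k : Spp p i z -> k != i -> inf (range (ratio z k)) <= F z.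
Proof.
move=> zS ki; rewrite -(ratio_avg z k)// -[leLHS]mul1r -(Spp_unit z k)// mulr_suml.
by apply: ler_sum => j _; apply: ler_wpM2l; rewrite ?powR_ge0 ?inf_range_le.
Qed.

Let gamma_minus_le z : Spp p i z -> gamma_minus f p i z <= F z `^ n.
Proof.
move=> zS; have z0 := Spp_gt0 _ zS; rewrite gamma_minusE//.
rewrite powR_mulrn ?(ltW (F_gt0 z z0))// -card_off -prodr_const; apply: ler_prod => k ki.
rewrite inf_le_F// andbT; apply: le_inf_range => // j.
by rewrite ltW// ratio_gt0.
Qed.

(** * The upper bound and uniqueness in it *)

Section UpperBound.
Variables (x z : vecs (R := R) d).
Hypotheses (xU : unit_orthant p x) (zS : Spp p i z).

Let z0 : off_gt0 z := Spp_gt0 _ zS.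
Let M k := sup (range (ratio z k)).
(** Factors making [avg_le] true: the quotients in block i all equal 1, those in block k are at most
    [M k], and f(ext z) = F(z). *)
Let A k := if k == i then (F z)^-1 else M k / F z.
Let bound := F z `^ q^-1 * \prod_(k | k != i) (M k / F z) `^ (n * q)^-1.

Let MF_ge1 k : k != i -> 1 <= M k / F z.
Proof. by move=> ki; rewrite ler_pdivlMr ?F_gt0// mul1r F_le_sup. Qed.

Let A_gt0 k : 0 < A k.
Proof.
rewrite /A; have [ki|ki] := eqVneq k i; first by rewrite invr_gt0 F_gt0.
exact: lt_le_trans (MF_ge1 k ki).
Qed.

Let avg_le k : \sum_j x k j `^ p k *
  (tgrad f k (ext z) j / ext z k j `^ (p k - 1)) <= A k * tform f (ext z).
Proof.
have [x0 x1] := xU; rewrite tform_ext// /A; have [ki|ki] := eqVneq k i.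
  subst k; rewrite mulVf ?gt_eqF ?F_gt0// -[leRHS](x1 i); apply: ler_sum => j _.
  rewrite ext_i// tgrad_dfwith -powRrM /q hconjB1// mulVf ?subr_eq0 ?gt_eqF//.
  have g0 : 0 < tgrad f i z j by apply: tgrad_gt0 => l l' /z0.
  by rewrite powRr1 ?(ltW g0)// divff ?mulr1// gt_eqF.
rewrite divfK ?gt_eqF ?F_gt0// -[leRHS]mul1r -[X in _ <= X * _](x1 k) mulr_suml.
apply: ler_sum => j _; apply: ler_wpM2l; first exact: powR_ge0.
by rewrite ext_off//; apply: le_sup_range.
Qed.

Let bound_powE : bound `^ (q * n) = gamma_plus f p i z.
Proof.
rewrite gamma_plusE// powRM ?powR_ge0 ?prodr_ge0//; last by move=> *; apply: powR_ge0.
rewrite -powRrM mulKf ?gt_eqF// powR_mulrn ?(ltW (F_gt0 z z0))//.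
rewrite -card_off -prodr_const powR_prod; last by move=> *; apply: powR_ge0.
rewrite -big_split /=; apply: eq_bigr => k ki.
rewrite [q * n]mulrC powRrVK ?gt_eqF// ?(le_trans ler01 (MF_ge1 k ki))//.
by rewrite mulrC divfK// gt_eqF// F_gt0.
Qed.

(** The factor at i turns F into F^(1/q). Elsewhere the bases are at least 1, so 1/p_k may be raised
    to 1/(n q); with this common exponent the powers of F cancel in [bound_powE]. *)
Let prod_le_bound :
  tform f (ext z) * \prod_k A k `^ (p k)^-1 <= bound.
Proof.
have F0 := F_gt0 z z0.
rewrite tform_ext// (bigD1 i)//= {1}/A eqxx mulrA.
rewrite -(powR_inv1 (ltW F0)) -powRrM mulN1r -{1}(powRr1 (ltW F0)).
rewrite -powRD ?(gt_eqF F0) ?implybT// -qVE; apply: ler_wpM2l; first exact: powR_ge0.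
apply: ler_prod => k ki; rewrite powR_ge0 /= /A (negbTE ki).
by apply: ler_powR; [exact: MF_ge1|exact: pV_le].
Qed.

Let ext_holder : tform f x <= tform f (ext z) * \prod_k A k `^ (p k)^-1.
Proof.
apply: tform_holder => //; [exact: sum_pV_le1|by case: xU|exact: ext_gt0].
Qed.

Let tform_ge0 : 0 <= tform f x.
Proof.
apply: sumr_ge0 => J _; rewrite mulr_ge0 ?f_ge0// prodr_ge0// => k _.
by case: xU.
Qed.

Lemma tform_le_gamma_plus : tform f x `^ (q * n) <= gamma_plus f p i z.
Proof.
rewrite -bound_powE; apply: ler_powR_base => //; first by rewrite mulrC ltW.
exact: le_trans ext_holder prod_le_bound.
Qed.

(* Equality in Hoelder makes x^p / (z^p * A) constant on the support of f, hence
   constant by connectivity; the constant is fixed by the normalisations. *)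
Lemma gamma_plus_eq_off : gamma_plus f p i z <= tform f x `^ (q * n) -> eq_off i x z.
Proof.
rewrite -bound_powE => le.
have qn0 : 0 < q * n by rewrite mulrC.
have b0 : 0 <= bound.
  by rewrite mulr_ge0 ?powR_ge0// prodr_ge0// => *; apply: powR_ge0.
have {}le : bound <= tform f x.
  rewrite leNgt; apply/negP => lt; move: le; rewrite leNgt => /negP; apply.
  by apply: gt0_ltr_powR; rewrite ?nnegrE.
have [x0 x1] := xU.
have eqT J (fJ : 0 < f J) k l : x k (J k) `^ p k / (ext z k (J k) `^ p k * A k) =
    x l (J l) `^ p l / (ext z l (J l) `^ p l * A l).
  move: J fJ k l; apply: tform_holder_eq => //; [exact: sum_pV_le1|exact: ext_gt0|].
  exact: le_trans prod_le_bound le.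
pose T (v : {k : 'I_m & 'I_(d k)}) := x (tag v) (tagged v) `^ p (tag v) /
  (ext z (tag v) (tagged v) `^ p (tag v) * A (tag v)).
have Tconst u v : T v = T u.
  apply: (connect_invariant _ _ (fun v => T v = T u) _ u v (f_irr u v) erefl).
  move=> {v} w v /andP[_ /existsP[J /and3P[/eqP Jw /eqP Jv fJ]]] <-.
  by rewrite /T -Jw -Jv; apply: eqT.
move=> k ki j.
pose c := T (Tagged (fun k => 'I_(d k)) j) * A k.
have xc a : x k a `^ p k = c * z k a `^ p k.
  rewrite /c (Tconst (Tagged (fun k => 'I_(d k)) a)) /T /= ext_off//.
  by field; rewrite !gt_eqF// powR_gt0// z0.
have c1 : c = 1.
  by rewrite -(x1 k) (eq_bigr _ (fun a _ => xc a)) -mulr_sumr Spp_unit// mulr1.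
apply: (@powR_inj_base _ (p k)) => //; first by rewrite ltW// z0.
by rewrite xc c1 mul1r.
Qed.

End UpperBound.

(** * Values at the maximizer and the lower bound *)

Section AtMaximizer.
Variable xs : vecs (R := R) d.
Hypothesis xsM : form_maximizer f p xs.

Let H := tform f xs.
Let xs_gt0 k j : 0 < xs k j.
Proof. by apply: form_maximizer_gt0 xsM _ _ => //; exact: sum_pV_le1. Qed.
Let xs_off : off_gt0 xs. Proof. by move=> k j _. Qed.

Let H_gt0 : 0 < H.
Proof.
rewrite /H (tform_tgrad f i) (bigD1 (Ordinal (d_gt0 i)))//= ltr_pwDl//.
  by rewrite mulr_gt0//; apply: tgrad_gt0.
by apply: sumr_ge0 => a _; rewrite mulr_ge0 ?ltW//; apply: tgrad_gt0.
Qed.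

(** By the critical equations, completing [xs] only rescales block i by H^(q-1); the other gradients
    acquire this factor on top of H. *)
Let ratio_xs k j : k != i -> ratio xs k j = H `^ q.
Proof.
move=> ki; rewrite /ratio.
have extE l a : ext xs l a = (if l == i then H `^ (q - 1) else 1) * xs l a.
  have [li|li] := eqVneq l i; last by rewrite ext_off// mul1r.
  subst l; rewrite ext_i// (form_maximizer_critical _ xsM i).2 -/H powRM ?powR_ge0 ?(ltW H_gt0)//.
  by rewrite -powRrM /q hconjB1// mulfV ?subr_eq0 ?gt_eqF// powRr1 ?ltW.
have -> : tgrad f k (ext xs) j = H `^ (q - 1) * tgrad f k xs j.
  rewrite /tgrad mulr_sumr; apply: eq_bigr => J _; rewrite mulrCA; congr (_ * _).
  under eq_bigr do rewrite extE.
  rewrite big_split /=; congr (_ * _).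
  rewrite (bigD1 i) 1?eq_sym//= eqxx big1 ?mulr1// => l /andP[_ /negbTE ->] //.
rewrite (form_maximizer_critical _ xsM k).2 -/H mulrA -mulrA divff ?mulr1 ?gt_eqF ?powR_gt0//.
by rewrite mulrC mulr_powRB1 ?ltW.
Qed.

(** Filling block i with the dual unit vector of the gradient attains Hölder's bound, so F(z)^(1/q)
    is a value of the form at a unit point. *)
Let optimal_extension z : Spp p i z -> exists2 x, unit_orthant p x &
  tform f x = F z `^ q^-1 /\ eq_off i x z.
Proof.
move=> zS; have z0 := Spp_gt0 _ zS; have F0 := F_gt0 z z0.
have g0 j : 0 < tgrad f i z j by apply: tgrad_gt0 => l l' /z0.
pose b j := (tgrad f i z j `^ q / F z) `^ (p i)^-1.
have bp j : b j `^ p i = tgrad f i z j `^ q / F z.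
  by rewrite powRrVK ?gt_eqF// divr_ge0 ?powR_ge0 ?ltW.
exists (@dfwith _ (fun k => 'I_(d k) -> R) z i b); last split.
- split=> k; case: dfwithP => [|l li].
  + by move=> j; apply: powR_ge0.
  + by move=> j; rewrite ltW// z0// eq_sym.
  + by rewrite (eq_bigr _ (fun j _ => bp j)) -mulr_suml mulfV ?gt_eqF.
  + by rewrite Spp_unit// eq_sym.
- rewrite tform_dfwith.
  have e j : b j * tgrad f i z j = tgrad f i z j `^ q * F z `^ (- (p i)^-1).
    rewrite /b powRM ?powR_ge0 ?invr_ge0 ?(ltW F0)// -powRrM.
    rewrite -(powR_inv1 (ltW F0)) -powRrM mulN1r mulrAC; congr (_ * _).
    have -> : q * (p i)^-1 = q - 1.
      rewrite -[(p i)^-1](subKr 1) -qVE mulrBr mulr1 mulfV//.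
      by rewrite gt_eqF.
    by rewrite mulrC mulr_powRB1 ?ltW.
  rewrite (eq_bigr _ (fun j _ => e j)) -mulr_suml -/(F z).
  by rewrite -{1}(powRr1 (ltW F0)) -powRD ?(gt_eqF F0) ?implybT// qVE.
- by move=> k ki j; rewrite dfwithout// eq_sym.
Qed.

Let F_le_H z : Spp p i z -> F z <= H `^ q.
Proof.
move=> zS; have [x xU [xF _]] := optimal_extension z zS.
rewrite -[leLHS](@powRrVK _ q) ?gt_eqF//; last by rewrite ltW// F_gt0//; apply: Spp_gt0.
apply: ler_powR_base; rewrite ?powR_ge0 ?(ltW q_gt0)// -xF.
by case: xsM => _; apply.
Qed.

(** All quotients equal H^q, so infima and suprema coincide. Agreement off i suffices because [ext]
    overwrites block i. *)
Let gamma_xs z : eq_off i z xs ->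
  gamma_minus f p i z = H `^ (q * n) /\ gamma_plus f p i z = H `^ (q * n).
Proof.
move=> zx.
have z0 : off_gt0 z by move=> k j ki; rewrite zx.
have extE : ext z = ext xs.
  apply: functional_extensionality_dep => k; rewrite /ext (tgrad_eq f i z xs)//.
  case: dfwithP => [|l li]; first by rewrite dfwithin.
  by rewrite dfwithout//; apply/funext => j; rewrite zx// eq_sym.
have rE k j : k != i -> ratio z k j = H `^ q.
  by move=> ki; rewrite -(ratio_xs k j ki) /ratio extE zx.
have powE : H `^ (q * n) = \prod_(k | k != i) H `^ q.
  by rewrite powRrM powR_mulrn ?powR_ge0// -card_off prodr_const.
rewrite gamma_minusE// gamma_plusE// powE; split; apply: eq_bigr => k ki.
  apply/eqP; rewrite eq_le -{1}(rE k (Ordinal (d_gt0 k)) ki) inf_range_le /=.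
  by apply: le_inf_range => // j; rewrite rE.
apply/eqP; rewrite eq_le -{2}(rE k (Ordinal (d_gt0 k)) ki) le_sup_range andbT.
by apply: sup_range_le => // j; rewrite rE.
Qed.

Lemma gamma_bounds z : Spp p i z ->
  [/\ gamma_minus f p i z <= H `^ (q * n), H `^ (q * n) <= gamma_plus f p i z,
      gamma_minus f p i z = H `^ (q * n) <-> eq_off i z xs
    & H `^ (q * n) = gamma_plus f p i z <-> eq_off i z xs].
Proof.
move=> zS; have Fn : F z `^ n <= H `^ (q * n).
  rewrite powRrM; apply: ler_powR_base; rewrite ?(ltW n0) ?F_le_H//.
  by rewrite ltW// F_gt0//; apply: Spp_gt0.
split.
- exact: le_trans (gamma_minus_le z zS) Fn.
- exact: tform_le_gamma_plus xsM.1 zS.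
- split=> [e|zx]; last by have [] := gamma_xs z zx.
  (* Equality below gives H^(qn) <= F(z)^n = f(x)^(qn) for the optimal extension [x] of [z]; this is
     equality in the upper bound at [xs], whose uniqueness applies to [x]. *)
  have [x xU [xF xz]] := optimal_extension z zS.
  have : eq_off i x xs.
    have xsS : Spp p i xs by apply: form_maximizer_Spp => //; exact: sum_pV_le1.
    apply: (gamma_plus_eq_off x xs xU xsS).
    have [_ ->] := gamma_xs xs (fun _ _ _ => erefl).
    have F0 : 0 <= F z by rewrite ltW// F_gt0//; apply: Spp_gt0.
    rewrite xF -e (powRrM (F z `^ q^-1) q n) (@powRrVK _ q (F z)) ?(gt_eqF q_gt0)//.
    exact: gamma_minus_le.
  by move=> xxs k ki j; rewrite -xz// xxs.
- split=> [e|zx]; last by have [_ ->] := gamma_xs z zx.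
  move=> k ki j; apply/esym; apply: gamma_plus_eq_off ki j => //; first by case: xsM.
  by rewrite -e.
Qed.

End AtMaximizer.

End PerronFrobenius.

Theorem theorem6 (R : realType) (m : nat) (d : 'I_m -> nat)
    (f : midx d -> R) (p : 'I_m -> R) (i : 'I_m) :
  (forall k, (0 < d k)%N) ->
  tnonneg f -> weakly_irreducible f ->
  (forall k, 1 < p k) ->
  (forall k, k != i -> (m - 1)%:R * hconj (p i) <= p k) ->
  exists xs : vecs d,
    Spp p i xs /\ Qi f p i xs = tnorm f p /\
    forall z : vecs d, Spp p i z ->
      let N := tnorm f p `^ (hconj (p i) * (m - 1)%:R) in
      [/\ gamma_minus f p i z <= N, N <= gamma_plus f p i z,
          gamma_minus f p i z = N <-> eq_off i z xs
        & N = gamma_plus f p i z <-> eq_off i z xs].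
Proof.
move=> d0 f0 fi p1 pl.
have sp := sum_pV_le1 p i p1 pl.
have [xs xsM] := form_maximizer_exists f p d0 p1.
have xsS := form_maximizer_Spp f p d0 p1 f0 fi sp i xs xsM.
exists xs; rewrite (tnorm_maximizer f p p1 f0 xs xsM); split=> //; split.
  rewrite /Qi (form_maximizer_critical f p f0 p1 xs xsM i).1.
  by rewrite big1 ?divr1// => k ki; have [] := xsS k ki.
move=> z zS /=; have [m1|m1] := ltnP 1 m.
  exact: (gamma_bounds f p i d0 f0 fi p1 pl m1 xs xsM).
(* For m = 1 no block other than i exists: both products are empty, the power of the norm has
   exponent 0, and [eq_off] is vacuous. *)
have noff k : (k != i) = false.
  apply/negbTE; rewrite negbK; apply/eqP/val_inj => /=.
  move: (leq_trans (ltn_ord k) m1) (leq_trans (ltn_ord i) m1).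
  by rewrite !ltnS !leqn0 => /eqP -> /eqP ->.
have -> : (m - 1 = 0)%N by apply/eqP; rewrite subn_eq0.
rewrite mulr0 powRr0 /gamma_minus /gamma_plus !big_pred0 //.
by split=> //; split=> // _ k; rewrite noff.
Qed.
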